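(* Let $\mathcal{K}$ be one of the following: the complex field $\mathbf{C}$, the semifield $\mathbf{R}_+$ of nonnegative real numbers with the usual arithmetic, or the max-times semifield $\mathbf{R}_+(\max)$. Let $V\subseteq\mathcal{K}^n$ be a nontrivial closed subspace, and let $\mathcal{S}$ be a commutative semigroup (under composition) of linear operators $\mathcal{K}^n\to\mathcal{K}^n$ such that $AV\subseteq V$ for all $A\in\mathcal{S}$. Then $\mathcal{S}$ has an eigenvector $v\in V$; that is, there is a nonzero $v\in V$ such that for each $A\in\mathcal{S}$ there is $\lambda_A\in\mathcal{K}$ with $Av=\lambda_A v$.
   Context: $\mathbf{R}_+(\max)$ is the set of nonnegative real numbers with addition $a\oplus b:=\max(a,b)$ and the usual multiplication. $\mathcal{K}^n$ is the $n$-fold product $\mathcal{K}\times\cdots\times\mathcal{K}$ with componentwise addition and scalar multiplication over $\mathcal{K}$ (so for $\mathcal{K}=\mathbf{R}_+(\max)$ addition of vectors is the componentwise maximum). Linear operators on $\mathcal{K}^n$ are the maps given by $n\times n$ matrices over $\mathcal{K}$, with matrix multiplication using the operations of $\mathcal{K}$. Subspaces of $\mathcal{K}^n$: for $\mathcal{K}=\mathbf{C}$ they are the usual linear subspaces of $\mathbf{C}^n$; for $\mathcal{K}=\mathbf{R}_+$ they are the convex cones in $\mathbf{R}_+^n$ (subsets containing $0$ and closed under addition and multiplication by nonnegative scalars); for $\mathcal{K}=\mathbf{R}_+(\max)$ they are the max cones, i.e. subsets of $\mathbf{R}_+^n$ containing $0$ and closed under componentwise maximum of vectors and multiplication by nonnegative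 scalars. A subspace is nontrivial if it contains a nonzero vector, and closed if it is closed in the usual Euclidean topology. A semigroup $\mathcal{S}$ of linear operators is commutative if $AB=BA$ for all $A,B\in\mathcal{S}$, i.e. $A(Bv)=B(Av)$ for all $v\in\mathcal{K}^n$. *)

(* Defs.v *)
From HB Require Import structures.
From mathcomp Require Import all_boot all_order all_algebra.
From mathcomp Require Import complex.
From mathcomp Require Import all_classical all_reals interval_inference.
From mathcomp Require Import topology normedtype.

Set Implicit Arguments.
Unset Strict Implicit.
Unset Printing Implicit Defensive.

Import Order.TTheory GRing.Theory Num.Theory.
Import numFieldNormedType.Exports.

Local Open Scope classical_set_scope.
Local Open Scope ring_scope.

#[short(type="topologicalSemiRingType")]
HB.structure Definition TopologicalComNzSemiRing :=
  {K of GRing.ComNzSemiRing K & Topological K}.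

(* The usual topology of the complex numbers, given by the modulus. *)
HB.instance Definition _ (R : realType) := PseudoPointedMetric.copy R[i] R[i]^o.

Definition nonneg_real (R : realType) : Type := {nonneg R}.

Section NonnegReal.
Variable R : realType.
Implicit Types x y : nonneg_real R.

HB.instance Definition _ := Order.Total.copy (nonneg_real R) {nonneg R}.
HB.instance Definition _ := SubType.copy (nonneg_real R) {nonneg R}.

Definition nn_zero : nonneg_real R := 0%:nng.
Definition nn_one : nonneg_real R := 1%:nng.
Definition nn_add x y : nonneg_real R := (x%:num + y%:num)%:nng.
Definition nn_mul x y : nonneg_real R := (x%:num * y%:num)%:nng.

Lemma nn_addA : associative nn_add.
Proof. by move=> x y z; apply: val_inj; rewrite /= addrA. Qed.

Lemma nn_addC : commutative nn_add.
Proof. by move=> x y; apply: val_inj; rewrite /= addrC. Qed.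

Lemma nn_add0 : left_id nn_zero nn_add.
Proof. by move=> x; apply: val_inj; rewrite /= add0r. Qed.

Lemma nn_mulA : associative nn_mul.
Proof. by move=> x y z; apply: val_inj; rewrite /= mulrA. Qed.

Lemma nn_mulC : commutative nn_mul.
Proof. by move=> x y; apply: val_inj; rewrite /= mulrC. Qed.

Lemma nn_mul1 : left_id nn_one nn_mul.
Proof. by move=> x; apply: val_inj; rewrite /= mul1r. Qed.

Lemma nn_mul0 : left_zero nn_zero nn_mul.
Proof. by move=> x; apply: val_inj; rewrite /= mul0r. Qed.

Lemma nn_mulDl : left_distributive nn_mul nn_add.
Proof. by move=> x y z; apply: val_inj; rewrite /= mulrDl. Qed.

Lemma nn_one_neq0 : nn_one != nn_zero.
Proof. by rewrite -val_eqE /= oner_neq0. Qed.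

HB.instance Definition _ := GRing.isNmodule.Build (nonneg_real R)
  nn_addA nn_addC nn_add0.
HB.instance Definition _ := GRing.Nmodule_isComNzSemiRing.Build (nonneg_real R)
  nn_mulA nn_mulC nn_mul1 nn_mulDl nn_mul0 nn_one_neq0.

HB.instance Definition _ := PseudoMetric.copy (nonneg_real R)
  (initial_topology (fun x : nonneg_real R => x%:num : R)).

End NonnegReal.

(* The semifield R_+(max): the order, the multiplication and the topology are
   those of the nonnegative reals, but the addition is the maximum. *)
Definition max_times (R : realType) : Type := nonneg_real R.

Section MaxTimes.
Variable R : realType.
Implicit Types x y : max_times R.

HB.instance Definition _ := Order.Total.on (max_times R).
HB.instance Definition _ := SubType.on (max_times R).

Lemma mt_leE x y : (x <= y)%O = (x%:num <= y%:num).
Proof. by []. Qed.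

Lemma mt_add0 : left_id (@nn_zero R : max_times R) Order.max.
Proof. by move=> x; apply: max_r; rewrite mt_leE; exact: ge0. Qed.

Lemma mt_mulDl :
  left_distributive (@nn_mul R : max_times R -> _ -> max_times R) Order.max.
Proof.
move=> x y z; case: (leP x y) => [xy|/ltW yx]; apply/esym.
- by apply: max_r; rewrite mt_leE ler_wpM2r.
- by apply: max_l; rewrite mt_leE ler_wpM2r.
Qed.

HB.instance Definition _ := GRing.isNmodule.Build (max_times R)
  (@maxA _ (max_times R)) (@maxC _ (max_times R)) mt_add0.
HB.instance Definition _ := GRing.Nmodule_isComNzSemiRing.Build (max_times R)
  (@nn_mulA R) (@nn_mulC R) (@nn_mul1 R) mt_mulDl (@nn_mul0 R) (@nn_one_neq0 R).

HB.instance Definition _ := PseudoMetric.copy (max_times R) (nonneg_real R).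

End MaxTimes.

Inductive scalar_kind := Complexes | NonnegReals | MaxTimes.

Definition scalars (R : realType) (k : scalar_kind) : topologicalSemiRingType :=
  match k with
  | Complexes => R[i]
  | NonnegReals => nonneg_real R
  | MaxTimes => max_times R
  end.

Section Subspaces.
Variables (K : topologicalSemiRingType) (n : nat).
Implicit Types (V : set 'cV[K]_n) (S : set 'M[K]_n).

(* Linear subspaces, convex cones containing 0, or max cones, according to K. *)
Definition is_subspace V :=
  [/\ V 0, (forall u v, V u -> V v -> V (u + v))
    & (forall (a : K) v, V v -> V (a *: v))].

Definition nontrivial V := exists2 v, V v & v != 0.

Definition is_semigroup S := forall A B, S A -> S B -> S (A *m B).

Definition commutative_family S :=
  forall A B, S A -> S B -> A *m B = B *m A.

Definition leaves_invariant (A : 'M[K]_n) V := forall v, V v -> V (A *m v).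

Definition is_common_eigenvector S (v : 'cV[K]_n) :=
  v != 0 /\ forall A, S A -> exists lambda : K, A *m v = lambda *: v.

End Subspaces.

(* Main.v *)
(* The nonnegative semifields are treated together, with the coordinatewise order.
   Fix [u] in the cone [V] and let [r] be the infimum of the [t] for which some
   [w >= u] satisfies [A w <= t w]. For [t > r] the Neumann series yields [w_t] in
   [V] with [t w_t = t u + A w_t]; the normalized [w_t] have a limit point [l] as
   [t] tends to [r], with [r l = r d u + A l] for some [d >= 0]. If [r d = 0] then
   [l] is an eigenvector. Otherwise [A l <= r l], and the iterates of [A / r] at [l]
   decrease to an eigenvector: were their limit [0], a value smaller than [r]
   would be admissible. Finitely many commuting operators then share an
   eigenvector by passing to successive eigenspaces, and compactness of the unit
   sphere of [V] handles arbitrary families. Over the complex numbers one passes to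
   eigenspaces of decreasing dimension. *)

Require Import Defs.
From mathcomp Require Import all_boot all_order all_algebra.
From mathcomp Require Import all_classical all_reals topology.
From mathcomp Require Import finmap complex interval_inference.
From mathcomp Require Import normedtype sequences.
From mathcomp Require Import ring lra.

Set Implicit Arguments.
Unset Strict Implicit.
Unset Printing Implicit Defensive.

Import Order.TTheory GRing.Theory Num.Theory.
Import numFieldNormedType.Exports.

Local Open Scope classical_set_scope.
Local Open Scope ring_scope.

(** For [x = 1 / (2 (m + 1))], Bernoulli's inequality keeps [(1 - x) ^+ m] above 1/2, so
    [c = 1 / (1 - x)] works. Once a power of an operator halves a vector, this [c] gives room for a
    smaller rate. *)
Lemma expr_le2_gt1 (R : realFieldType) m : exists2 c : R, 1 < c & c ^+ m <= 2.
Proof.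
have M1 : 1 <= m.+1%:R :> R by rewrite ler1n.
pose x : R := (2 * m.+1%:R)^-1.
have x0 : 0 < x by rewrite invr_gt0; lra.
have x1 : x < 1 by rewrite invf_lt1; lra.
have bernoulli k : 1 - x *+ k <= (1 - x) ^+ k.
  elim: k => [|k IHk]; first by rewrite mulr0n subr0.
  rewrite exprSr; apply: le_trans (ler_wpM2r _ IHk); last lra.
  have : 0 <= x * (x *+ k) by rewrite mulr_ge0 ?mulrn_wge0 ?ltW.
  rewrite mulrSr; set y := x *+ k; nra.
exists (1 - x)^-1; first by rewrite invf_gt1; lra.
rewrite exprVn -[leRHS]invrK lef_pV2 ?posrE ?exprn_gt0 ?invr_gt0 ?subr_gt0//.
apply: le_trans (bernoulli m).
have xM : x * m.+1%:R = 1 / 2 by rewrite /x; field; rewrite gt_eqF; lra.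
by move: xM; rewrite mulr_natr mulrS; lra.
Qed.

(* Common abstraction of R_+ and R_+(max), whose addition lies between the maximum
   and the sum; [p] is the inclusion into the reals. *)
Record nonneg_embedding (R : realType) (K : topologicalSemiRingType)
    (p : K -> R) : Prop := NonnegEmbedding {
  emb_inj : injective p;
  emb_ge0 : forall a, 0 <= p a;
  emb_onto : forall x, 0 <= x -> exists a, p a = x;
  embM : {morph p : a b / a * b};
  embD_le : forall a b, p (a + b) <= p a + p b;
  emb_leDl : forall a b, p a <= p (a + b);
  embD_mono : forall a b c, p a <= p b -> p (a + c) <= p (b + c);
  emb_cvgD : forall (T : Type) (F : set_system T) (f g : T -> K) a b,
    Filter F -> p (f x) @[x --> F] --> p a -> p (g x) @[x --> F] --> p b ->
    p (f x + g x) @[x --> F] --> p (a + b);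
  emb_cvg : forall (T : Type) (F : set_system T) (f : T -> K) a,
    Filter F -> p (f x) @[x --> F] --> p a -> f x @[x --> F] --> a
}.

(** * Limits along ultrafilters *)

Lemma fmap_ultra (T U : Type) (f : T -> U) (F : set_system T) :
  UltraFilter F -> UltraFilter (f x @[x --> F]).
Proof.
move=> FU; split; first exact: fmap_proper_filter.
move=> G GF FG; apply/seteqP; split=> A; last exact: FG.
move=> GA; have [//|FnA] := in_ultra_setVsetC (f @^-1` A) FU.
have /FG GnA : (f x @[x --> F]) (~` A) by [].
by have [x []] := filter_ex (filterI GA GnA).
Qed.

Lemma ultra_cvg_segment (R : realType) (T : Type) (F : set_system T)
    (FU : UltraFilter F) (a b : R) (f : T -> R) :
  (\forall x \near F, a <= f x <= b) ->
  exists l, a <= l /\ f x @[x --> F] --> l.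
Proof.
move=> fab; have := @segment_compact R a b.
rewrite compact_ultra => /(_ (f x @[x --> F]) (fmap_ultra f FU))[|l [lab fl]].
  by apply: filterS fab => x; rewrite /= in_itv.
by exists l; split=> //; move: lab; rewrite /= in_itv /= => /andP[].
Qed.

(** * Scalars embedded in the nonnegative reals *)

Section Embedding.
Context {R : realType} {K : topologicalSemiRingType} {p : K -> R}.
Hypothesis pE : nonneg_embedding p.

Let p_ge0 := emb_ge0 pE.
Let pM := embM pE.

Lemma emb0 : p 0 = 0.
Proof.
by have [a pa] := emb_onto pE (lexx 0); rewrite -(mul0r a) pM pa mulr0.
Qed.

Lemma emb_eq0 a : p a = 0 -> a = 0.
Proof. by rewrite -emb0; apply: (emb_inj pE). Qed.

Lemma emb1 : p 1 = 1.
Proof.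
have p1 : p 1 != 0 by apply/eqP => /emb_eq0/eqP; apply/negP; exact: oner_neq0.
by apply: (mulfI p1); rewrite -pM !mulr1.
Qed.

(** Injectivity of [p] makes the chosen preimage unique; the default 0 is taken exactly on negative
    reals. *)
Definition emb_inv (x : R) : K := xget 0 [set a | p a = x].

Lemma emb_invK x : 0 <= x -> p (emb_inv x) = x.
Proof.
move=> /(emb_onto pE)[a pa].
by apply: (@xgetPex _ 0 [set a | p a = x]); exists a.
Qed.

Lemma emb_invM x y : 0 <= x -> 0 <= y ->
  emb_inv (x * y) = emb_inv x * emb_inv y.
Proof.
by move=> x0 y0; apply: (emb_inj pE); rewrite pM !emb_invK// mulr_ge0.
Qed.

Lemma emb_inv0 : emb_inv 0 = 0.
Proof. by apply: emb_eq0; rewrite emb_invK. Qed.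

Lemma emb_inv1 : emb_inv 1 = 1.
Proof. by apply: (emb_inj pE); rewrite emb_invK// emb1. Qed.

Lemma emb_cvg_sum (T I : Type) (F : set_system T) (s : seq I)
    (f : I -> T -> K) (a : I -> K) : Filter F ->
  (forall i, p (f i x) @[x --> F] --> p (a i)) ->
  p (\sum_(i <- s) f i x) @[x --> F] --> p (\sum_(i <- s) a i).
Proof.
move=> FF fa; elim: s => [|i s IHs].
  by rewrite big_nil; under eq_fun do rewrite big_nil; exact: cvg_cst.
rewrite big_cons; under eq_fun do rewrite big_cons.
exact: (emb_cvgD pE).
Qed.

(** * Order, norm and convergence of vectors *)

Context {n : nat}.
Implicit Types (u v w : 'cV[K]_n) (A : 'M[K]_n).

Definition lev u v := forall i, p (u i 0) <= p (v i 0).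

Lemma lev_refl u : lev u u. Proof. by []. Qed.

Lemma lev_trans v u w : lev u v -> lev v w -> lev u w.
Proof. by move=> uv vw i; exact: le_trans (uv i) (vw i). Qed.

Lemma emb_leD a b c d : p a <= p b -> p c <= p d -> p (a + c) <= p (b + d).
Proof.
move=> ab cd; apply: le_trans (embD_mono pE c ab) _.
by rewrite ![b + _]addrC; exact: embD_mono.
Qed.

Lemma lev_add u u' v v' : lev u u' -> lev v v' -> lev (u + v) (u' + v').
Proof. by move=> uu vv i; rewrite !mxE; exact: emb_leD. Qed.

Lemma lev_addl u v : lev u (u + v).
Proof. by move=> i; rewrite !mxE; exact: emb_leDl. Qed.

Lemma lev_scale (a : K) u v : lev u v -> lev (a *: u) (a *: v).
Proof. by move=> uv i; rewrite !mxE !pM ler_wpM2l. Qed.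

Lemma lev_mul A u v : lev u v -> lev (A *m u) (A *m v).
Proof.
move=> uv i; rewrite !mxE.
apply: (big_ind2 (fun a b => p a <= p b)) => //; first exact: emb_leD.
by move=> j _; rewrite !pM ler_wpM2l.
Qed.

Definition sum_norm u : R := \sum_i p (u i 0).

Lemma sum_norm_ge0 u : 0 <= sum_norm u.
Proof. exact: sumr_ge0. Qed.

Lemma le_sum_norm u i : p (u i 0) <= sum_norm u.
Proof. by rewrite /sum_norm (bigD1 i)//= lerDl sumr_ge0. Qed.

Lemma sum_norm_gt0 u : u != 0 -> 0 < sum_norm u.
Proof.
move=> u0; rewrite lt_def sum_norm_ge0 andbT; apply: contra u0 => /eqP u0.
apply/eqP/matrixP => i j; rewrite ord1 mxE; apply: emb_eq0; apply/eqP.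
by rewrite eq_le p_ge0 andbT -u0 le_sum_norm.
Qed.

Lemma sum_norm_neq0 u : sum_norm u != 0 -> u != 0.
Proof.
apply: contra_neq => ->; apply: big1 => i _; rewrite mxE; exact: emb0.
Qed.

Lemma sum_normZ a u : sum_norm (a *: u) = p a * sum_norm u.
Proof.
by rewrite /sum_norm mulr_sumr; apply: eq_bigr => i _; rewrite mxE pM.
Qed.

Lemma le_sum_normv u v : lev u v -> sum_norm u <= sum_norm v.
Proof. by move=> uv; apply: ler_sum. Qed.

(** Convergence is read through [p], so that real limits apply; [tends_cvg] brings it back to the
    topology of [K]. *)
Definition tends (T : Type) (F : set_system T) (f : T -> 'cV[K]_n) v :=
  forall i, p (f x i 0) @[x --> F] --> p (v i 0).

Lemma tends_cvg (T : Type) (F : set_system T) (f : T -> 'cV[K]_n) v :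
  Filter F -> tends F f v -> f x @[x --> F] --> v.
Proof.
move=> FF fv A [P vP PA].
have /filter_forall H : forall i : 'I_n, \forall x \near F, P i 0 (f x i 0).
  by move=> i; apply: (emb_cvg pE FF (fv i)).
apply: filterS H => x Px; apply: PA => i j; rewrite ord1; exact: Px.
Qed.

Section Tends.
Context {T : Type} {F : set_system T} {FF : ProperFilter F}.
Implicit Types f g : T -> 'cV[K]_n.

Lemma tends_cst v : tends F (fun=> v) v.
Proof. by move=> i; exact: cvg_cst. Qed.

Lemma tends_add f g u v :
  tends F f u -> tends F g v -> tends F (fun x => f x + g x) (u + v).
Proof.
move=> fu gv i; rewrite mxE; under eq_fun do rewrite mxE.
exact: (emb_cvgD pE).
Qed.

Lemma tends_scale (c : T -> K) f a u :
  p (c x) @[x --> F] --> p a -> tends F f u ->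
  tends F (fun x => c x *: f x) (a *: u).
Proof.
move=> ca fu i; rewrite mxE pM; under eq_fun do rewrite mxE pM.
exact: cvgM.
Qed.

Lemma tends_mul A f u : tends F f u -> tends F (fun x => A *m f x) (A *m u).
Proof.
move=> fu i; rewrite mxE; under eq_fun do rewrite mxE.
apply: emb_cvg_sum => j; rewrite pM; under eq_fun do rewrite pM.
exact: cvgMl_tmp.
Qed.

Lemma tends_unique f u v : tends F f u -> tends F f v -> u = v.
Proof.
move=> fu fv; apply/matrixP => i j; rewrite ord1; apply: (emb_inj pE).
exact: cvg_unique (fu i) (fv i).
Qed.

Lemma tends_sum_norm f u :
  tends F f u -> sum_norm (f x) @[x --> F] --> sum_norm u.
Proof. by move=> fu; apply: cvg_big => //; exact: add_continuous. Qed.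

End Tends.

Lemma tends_coord (T : Type) (F : set_system T) (f : T -> 'cV[K]_n) :
  ProperFilter F -> (forall i, cvg (p (f x i 0) @[x --> F])) ->
  exists v, tends F f v.
Proof.
move=> FF fc.
have /choice[a fa] i : exists a, p (f x i 0) @[x --> F] --> p a.
  have [|a pa] := emb_onto pE (x := lim (p (f x i 0) @[x --> F])).
    by apply: limr_ge => //; apply: nearW.
  by exists a; rewrite pa.
by exists (\col_i a i) => i; rewrite mxE.
Qed.

(** This is compactness of balls: each coordinate stays in the segment from 0 to [M]. *)
Lemma tends_ultra (T : Type) (F : set_system T) (f : T -> 'cV[K]_n) M :
  UltraFilter F -> (\forall x \near F, sum_norm (f x) <= M) ->
  exists v, tends F f v.
Proof.
move=> FU fM; apply: tends_coord => i.
have [|l [_ /cvgP//]] := @ultra_cvg_segment R T F _ 0 M (fun x => p (f x i 0)).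
by apply: filterS fM => x fxM; rewrite p_ge0 (le_trans (le_sum_norm _ _)).
Qed.

Lemma tends_nondecreasing (s : nat -> 'cV[K]_n) w :
  (forall k, lev (s k) (s k.+1)) -> (forall k, lev (s k) w) ->
  exists v, tends \oo s v.
Proof.
move=> s_nd s_w; apply: tends_coord => i; apply: nondecreasing_is_cvgn.
  by apply/nondecreasing_seqP => k; exact: s_nd.
by exists (p (w i 0)) => _ [k _ <-]; exact: s_w.
Qed.

Lemma tends_nonincreasing (s : nat -> 'cV[K]_n) :
  (forall k, lev (s k.+1) (s k)) -> exists v, tends \oo s v.
Proof.
move=> s_ni; apply: tends_coord => i; apply: nonincreasing_is_cvgn.
  by apply/nonincreasing_seqP => k; exact: s_ni.
by exists 0 => _ [k _ <-].
Qed.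

(** Unlike topological closedness, this form passes to eigenspaces by mere uniqueness of limits. *)
Definition tends_closed (V : set 'cV[K]_n) := forall (T : Type)
  (F : set_system T) (f : T -> 'cV[K]_n) v, ProperFilter F ->
  (\forall x \near F, V (f x)) -> tends F f v -> V v.

Lemma closed_tends (V : set 'cV[K]_n) : closed V -> tends_closed V.
Proof.
by move=> Vc T F f v FF Vf /tends_cvg fv; apply: (closed_cvg V Vc Vf v fv).
Qed.

Lemma lev0 u : lev 0 u.
Proof. by move=> i; rewrite mxE emb0. Qed.

Lemma scale_emb_invA x y u : 0 <= x -> 0 <= y ->
  emb_inv x *: (emb_inv y *: u) = emb_inv (x * y) *: u.
Proof. by move=> x0 y0; rewrite scalerA -emb_invM. Qed.

Lemma scale_emb_inv1 u : emb_inv 1 *: u = u.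
Proof. by rewrite emb_inv1 scale1r. Qed.

(** The vector [w] ranges over the whole space rather than the cone, so constant vectors qualify; it
    only serves as an upper bound. *)
Definition supersolution A t u w := lev u w /\ lev (A *m w) (emb_inv t *: w).

(** The sum of all entries of [A] dominates every row sum, hence the growth of a constant vector
    above [u]. *)
Lemma supersolution_exists A u :
  exists2 t, 0 <= t & exists w, supersolution A t u w.
Proof.
pose t : R := \sum_i \sum_j p (A i j).
have t_ge0 : 0 <= t by apply: sumr_ge0 => i _; exact: sumr_ge0.
exists t => //; exists (const_mx (emb_inv (sum_norm u))); split=> i.
  by rewrite mxE emb_invK ?sum_norm_ge0 ?le_sum_norm.
rewrite !mxE pM !emb_invK ?sum_norm_ge0//.
apply: (@le_trans _ _ (\sum_j p (A i j) * sum_norm u)).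
  elim/big_ind2: _ => [|a x b y ax b_y|j _]; first by rewrite emb0.
    exact: le_trans (embD_le pE _ _) (lerD ax b_y).
  by rewrite mxE pM emb_invK ?sum_norm_ge0.
rewrite -mulr_suml ler_wpM2r ?sum_norm_ge0// /t [leRHS](bigD1 i)//= lerDl.
by apply: sumr_ge0 => k _; exact: sumr_ge0.
Qed.

(** * Eigenvector of one operator in a closed cone *)

Section Cone.
Context {V : set 'cV[K]_n}.
Hypotheses (Vs : is_subspace V) (Vc : tends_closed V).

Let V0 : V 0. Proof. by have [] := Vs. Qed.
Let VD u v : V u -> V v -> V (u + v). Proof. by have [_ + _] := Vs; apply. Qed.
Let VZ a v : V v -> V (a *: v). Proof. by have [_ _] := Vs; apply. Qed.
Let Vlim T (F : set_system T) f v :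
  ProperFilter F -> (forall x, V (f x)) -> tends F f v -> V v.
Proof. by move=> FF Vf; apply: Vc; exact: nearW. Qed.

Section Operator.
Context {A : 'M[K]_n}.
Hypothesis VA : leaves_invariant A V.

(* The partial sums of the Neumann series increase, and the supersolution bounds
   them. *)
Lemma resolvent_solution (t' t : R) u w :
  V u -> 0 <= t' -> t' < t -> supersolution A t' u w ->
  exists2 x, V x & x = u + emb_inv t^-1 *: (A *m x).
Proof.
move=> Vu t'0 t't [uw Aw].
have t0 : 0 < t by exact: le_lt_trans t't.
have tt' : 0 < t - t' by rewrite subr_gt0.
(* [C] solves [1 + (t' / t) C = C], so the bound [C w] is preserved by [g]. *)
pose C := t / (t - t').
have C0 : 0 <= C by rewrite divr_ge0// ltW.
pose g x := u + emb_inv t^-1 *: (A *m x).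
pose s k := iter k g 0.
have g_mono x y : lev x y -> lev (g x) (g y).
  by move=> xy; apply: lev_add; [exact: lev_refl|exact/lev_scale/lev_mul].
have s_nd k : lev (s k) (s k.+1).
  by elim: k => [|k IHk]; [exact: lev0|exact: g_mono].
have s_C k : lev (s k) (emb_inv C *: w).
  elim: k => [|k IHk]; first exact: lev0.
  apply: lev_trans (g_mono _ _ IHk) _ => i.
  rewrite /g -scalemxAr mxE; apply: le_trans (embD_le pE _ _) _.
  rewrite ![in leLHS]mxE ![in leRHS]mxE !pM !emb_invK ?invr_ge0 ?(ltW t0)//.
  have := Aw i; rewrite [in leRHS]mxE pM emb_invK// => {}Aw.
  apply: (@le_trans _ _ (p (w i 0) + t^-1 * (C * (t' * p (w i 0))))).
    rewrite mxE in Aw.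
    by rewrite lerD// ler_wpM2l ?invr_ge0 ?(ltW t0)// ler_wpM2l.
  rewrite le_eqVlt; apply/orP; left; apply/eqP; rewrite /C; field.
  by rewrite !gt_eqF.
have Vsk k : V (s k) by elim: k => [//|k IHk]; apply: VD => //; exact/VZ/VA.
have [x sx] := tends_nondecreasing s_nd s_C.
have Vx : V x by exact: (Vlim _ Vsk sx).
exists x => //; apply: (tends_unique (F := \oo) (f := fun k => s k.+1)).
  by move=> i; rewrite (cvg_shiftS (fun k => p (s k i 0))); exact: sx.
apply: tends_add; first exact: tends_cst.
by apply: tends_scale; [exact: cvg_cst|exact: tends_mul].
Qed.

(* If the decreasing iterates of [A / r] at [v] tend to [0], then some power
   of [A / r] halves [v], and a partial Neumann series at a slightly smaller
   [s] is again a supersolution. *)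
Lemma eigenvector_or_smaller_supersolution (r : R) v :
  0 < r -> V v -> supersolution A r v v ->
  (exists2 y, V y & y != 0 /\ A *m y = emb_inv r *: y) \/
  (exists2 s, 0 <= s < r & exists w, supersolution A s v w).
Proof.
move=> r0 Vv [_ Av].
have rV0 : 0 <= r^-1 by rewrite invr_ge0 ltW.
pose y k := iter k (fun x => emb_inv r^-1 *: (A *m x)) v.
have Ay k : A *m y k = emb_inv r *: y k.+1.
  rewrite scale_emb_invA ?(ltW r0)// divff ?gt_eqF//.
  by rewrite scale_emb_inv1.
have y_ni k : lev (y k.+1) (y k).
  elim: k => [|k IHk] /=; last exact/lev_scale/lev_mul.
  have := lev_scale (emb_inv r^-1) Av.
  by rewrite scale_emb_invA ?(ltW r0)// mulVf ?gt_eqF// scale_emb_inv1.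
have y_v k : lev (y k) v.
  by elim: k => [|k]; [exact: lev_refl|exact: lev_trans].
have Vy k : V (y k) by elim: k => [//|k IHk]; exact/VZ/VA.
have [l yl] := tends_nonincreasing y_ni.
have Vl : V l by exact: (Vlim _ Vy yl).
have Al : A *m l = emb_inv r *: l.
  apply: (tends_unique (F := \oo) (f := fun k => A *m y k)).
    exact: tends_mul.
  under eq_fun do rewrite Ay.
  apply: tends_scale; first exact: cvg_cst.
  by move=> i; rewrite (cvg_shiftS (fun k => p (y k i 0))); exact: yl.
have [l0|] := eqVneq l 0; [right|by left; exists l].
have /filter_forall H : forall i : 'I_n,
    \forall k \near \oo, p (y k i 0) <= p (v i 0) / 2.
  move=> i; have := yl i; rewrite l0 mxE emb0 => yi0.
  (* Where [v] vanishes the limit alone gives no strict margin, but there the iterates are already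
     0. *)
  have [vi0|vi0] := ltP 0 (p (v i 0)).
    by apply: (cvgr_le _ yi0); rewrite divr_gt0.
  near=> k; apply: le_trans (y_v k i) _.
  have -> : p (v i 0) = 0 by apply/eqP; rewrite eq_le vi0 p_ge0.
  by rewrite mul0r.
have [m ym] : exists m, forall i, p (y m.+1 i 0) <= p (v i 0) / 2.
  near \oo => k; exists k.-1 => i.
  rewrite prednK; last by near: k; exact: nbhs_infty_gt.
  by move: i; near: k.
have [c c1 cm] := expr_le2_gt1 R m.+1.
have c0 : 0 < c by exact: lt_trans c1.
(* Weighting the iterates by powers of [c] gives [A x_k = s x_(k+1)], and [c ^+ m.+1 <= 2] cancels
   the halving, so [x_(m+1) <= x_0]. *)
pose s := r / c.
have s0 : 0 < s by exact: divr_gt0.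
pose x k := emb_inv (c ^+ k) *: y k.
have x0 : x 0%N = v by rewrite /x expr0 scale_emb_inv1.
have Ax k : A *m x k = emb_inv s *: x k.+1.
  rewrite /x -scalemxAr Ay scale_emb_invA ?exprn_ge0 ?(ltW c0)//;
    last exact: ltW.
  rewrite scale_emb_invA ?exprn_ge0 ?(ltW c0)//; last exact: ltW.
  by congr (emb_inv _ *: _); rewrite /s exprS; field; rewrite gt_eqF.
have xm : lev (x m.+1) (x 0%N).
  move=> i; rewrite x0 mxE pM emb_invK ?exprn_ge0 ?(ltW c0)//.
  apply: (@le_trans _ _ (2 * (p (v i 0) / 2))).
    by rewrite ler_pM ?exprn_ge0 ?(ltW c0).
  by rewrite mulrC divfK.
exists s; first by rewrite ltW//= ltr_pdivrMr// ltr_pMr.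
(* [A] shifts the summands and multiplies by [s]; the new last term is at most the lost first
   one. *)
exists (\sum_(k < m.+1) x k); split.
  by rewrite big_ord_recl /= x0; exact: lev_addl.
rewrite mulmx_sumr (eq_bigr (fun k : 'I_m.+1 => emb_inv s *: x k.+1)) => [|//].
rewrite -scaler_sumr; apply: lev_scale.
rewrite big_ord_recr big_ord_recl /= addrC; exact: lev_add.
Unshelve. all: by end_near. Qed.

Lemma eigenvector_exists : nontrivial V ->
  exists2 v, V v & v != 0 /\ exists a, A *m v = a *: v.
Proof.
move=> [u Vu u0].
pose E := [set t : R | 0 <= t /\ exists w, supersolution A t u w].
have E0 : E !=set0 by have [t t0 tw] := supersolution_exists A u; exists t.
have Elb : has_lbound E by exists 0 => t [].
pose r := inf E.
have r0 : 0 <= r by apply: lb_le_inf => // t [].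
pose t k := r + harmonic k.
have t_gt k : r < t k by rewrite ltrDl harmonic_gt0.
have t0 k : 0 < t k by exact: le_lt_trans (t_gt k).
have t_r : t k @[k --> \oo] --> r.
  by rewrite -[r]addr0; apply: cvgD; [exact: cvg_cst|exact: cvg_harmonic].
have /choice[w Hw] : forall k, exists x,
    V x /\ x = u + emb_inv (t k)^-1 *: (A *m x).
  move=> k; have [t' [t'0 [x ux]] t't] := inf_lt E0 (t_gt k).
  by have [y] := resolvent_solution Vu t'0 t't ux; exists y.
(* These norms may be unbounded, but their inverses are bounded by that of [u], so [d] below exists
   and is 0 if the norms blow up. *)
pose N k := sum_norm (w k).
have N_ge k : sum_norm u <= N k.
  by apply: le_sum_normv; rewrite (Hw k).2; exact: lev_addl.
have N0 k : 0 < N k by exact: lt_le_trans (sum_norm_gt0 u0) (N_ge k).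
have NV0 k : 0 <= (N k)^-1 by rewrite invr_ge0 ltW.
pose v k := emb_inv (N k)^-1 *: w k.
have v1 k : sum_norm (v k) = 1 by rewrite sum_normZ emb_invK// mulVf ?gt_eqF.
have Ev k : emb_inv (t k) *: v k = emb_inv (t k / N k) *: u + A *m v k.
  have [tk0 Nk0] := (ltW (t0 k), ltW (N0 k)).
  rewrite /v {1}(Hw k).2 !scalerDr -scalemxAr.
  rewrite !scale_emb_invA ?mulr_ge0 ?invr_ge0//.
  congr (_ + emb_inv _ *: _); field.
  by rewrite !gt_eqF.
(* One ultrafilter finer than the filter at infinity makes the normalized vectors and the inverse
   norms converge together. *)
have [G [GU sG]] := ultraFilterLemma (_ : ProperFilter \oo).
have [l vl] : exists l, tends G v l.
  by apply: (@tends_ultra _ _ _ 1) => //; apply: nearW => k; rewrite v1.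
have [d [d0 Nd]] : exists d : R, 0 <= d /\ (N k)^-1 @[k --> G] --> d.
  apply: (@ultra_cvg_segment _ _ _ _ _ (sum_norm u)^-1).
  apply: nearW => k; rewrite NV0 lef_pV2 ?posrE ?N0 ?N_ge//.
  exact: sum_norm_gt0.
have tG : t k @[k --> G] --> r by move=> B /t_r; exact: sG.
have Vl : V l by apply: (Vlim _ _ vl) => k; apply/VZ/(Hw k).1.
have l1 : sum_norm l = 1.
  have v1G : sum_norm (v k) @[k --> G] --> (1 : R).
    by under eq_fun do rewrite v1; exact: cvg_cst.
  exact: cvg_unique (tends_sum_norm vl) v1G.
have l_neq0 : l != 0 by apply: sum_norm_neq0; rewrite l1 oner_neq0.
have El : emb_inv r *: l = emb_inv (r * d) *: u + A *m l.
  apply: (tends_unique (F := G) (f := fun k => emb_inv (t k) *: v k)).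
    apply: tends_scale => //; rewrite emb_invK//.
    under eq_fun do rewrite emb_invK ?ltW//.
    exact: tG.
  under eq_fun do rewrite Ev.
  apply: tends_add; last exact: tends_mul.
  apply: tends_scale; last exact: tends_cst.
  rewrite emb_invK ?mulr_ge0//.
  under eq_fun do rewrite emb_invK ?mulr_ge0 ?(ltW (t0 _))//.
  exact: cvgM.
have [rd0|rd0] := eqVneq (r * d) 0.
  exists l => //; split=> //; exists (emb_inv r).
  by rewrite El rd0 emb_inv0 scale0r add0r.
have [r_gt0 d_gt0] : 0 < r /\ 0 < d.
  by move: rd0; rewrite mulf_eq0 negb_or !lt_def r0 d0 !andbT => /andP[].
have Al : supersolution A r l l.
  by split; [exact: lev_refl|rewrite El addrC; exact: lev_addl].
have [[y Vy [y0 Ay]]|[s /andP[s0 sr] [x [lx Ax]]]] :=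
  eigenvector_or_smaller_supersolution r_gt0 Vl Al.
  by exists y => //; split=> //; exists (emb_inv r).
(* Since [r d u <= r l], one has [u <= l / d <= x / d], so [x / d] makes [s] admissible for [u],
   against the choice of [r] as infimum. *)
have : r <= s.
  apply: ge_inf => //; split=> //; exists (emb_inv d^-1 *: x).
  split; last first.
    by rewrite -scalemxAr scalerA mulrC -scalerA; exact: lev_scale.
  apply: lev_trans (lev_scale _ lx).
  have := lev_addl (emb_inv (r * d) *: u) (A *m l).
  rewrite -El => /(lev_scale (emb_inv (r * d)^-1)).
  rewrite !scale_emb_invA ?invr_ge0 ?mulr_ge0//.
  rewrite mulVf// scale_emb_inv1; congr (lev _ (emb_inv _ *: _)); field.
  by rewrite !gt_eqF.
by rewrite leNgt sr.
Qed.

End Operator.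
End Cone.

(** * Common eigenvectors of commuting operators on a cone *)

Lemma tends_near (T : Type) (F : set_system T) (f g : T -> 'cV[K]_n) v :
  Filter F -> (\forall x \near F, f x = g x) -> tends F f v -> tends F g v.
Proof.
move=> FF fg fv i; apply: cvg_trans _ (fv i).
by apply: near_eq_cvg; apply: filterS fg => x ->.
Qed.

Lemma eigenspace_subspace V A a : is_subspace V ->
  is_subspace [set v | V v /\ A *m v = a *: v].
Proof.
move=> [V0 VD VZ]; split=> [|u v [Vu Au] [Vv Av]|b v [Vv Av]].
- by rewrite /= mulmx0 scaler0.
- by split; [exact: VD|rewrite mulmxDr Au Av scalerDr].
- by split; [exact: VZ|rewrite -scalemxAr Av !scalerA mulrC].
Qed.

Lemma eigenspace_closed V A a : tends_closed V ->
  tends_closed [set v | V v /\ A *m v = a *: v].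
Proof.
move=> Vc T F f v FF Vf fv; split.
  by apply: (Vc _ _ _ _ _ _ fv); apply: filterS Vf => x [].
apply: (tends_unique (F := F) (f := fun x => A *m f x)); first exact: tends_mul.
apply: (@tends_near _ _ (fun x => a *: f x)).
  by apply: filterS Vf => x [_ ->].
by apply: tends_scale => //; exact: cvg_cst.
Qed.

(** An eigenspace of the first operator within [V] is again a nontrivial closed cone, invariant
    under the others because they commute with it. *)
Lemma common_eigenvector_seq (As : seq 'M[K]_n) V :
  is_subspace V -> tends_closed V -> nontrivial V ->
  (forall A, A \in As -> leaves_invariant A V) ->
  {in As &, forall A B, A *m B = B *m A} ->
  exists2 v, V v & v != 0 /\ forall A, A \in As -> exists a, A *m v = a *: v.
Proof.
elim: As V => [|A As IHAs] V Vs Vc Vn VA AC.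
  by have [v Vv v0] := Vn; exists v.
have AsA B : B \in As -> B \in A :: As by rewrite inE orbC => ->.
have AA : A \in A :: As by exact: mem_head.
have [v Vv [v0 [a Av]]] := eigenvector_exists Vs Vc (VA _ AA) Vn.
have [|||B /AsA BAs u [Vu Au]|B C /AsA BAs /AsA CAs|u [Vu Au] [u0 Eu]] :=
  IHAs [set v | V v /\ A *m v = a *: v].
- exact: eigenspace_subspace.
- exact: eigenspace_closed.
- by exists v.
- split; first exact: VA.
  by rewrite mulmxA (AC A B)// -mulmxA Au scalemxAr.
- exact: AC.
exists u => //; split=> // B; rewrite inE => /predU1P[->|/Eu//].
by exists a.
Qed.

(* On vectors of norm 1 the eigenvalue is [|A v|], so being an eigenvector is a
   closed condition. *)
Lemma common_eigenvector_family V (S : set 'M[K]_n) :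
  is_subspace V -> tends_closed V -> nontrivial V ->
  (forall A, S A -> leaves_invariant A V) -> commutative_family S ->
  exists2 v, V v & is_common_eigenvector S v.
Proof.
move=> Vs Vc Vn VS SC; have [_ _ VZ] := Vs.
pose E A := [set v | [/\ V v, sum_norm v = 1 & exists a, A *m v = a *: v]].
(* The empty family is set apart: the norm bound for the ultrafilter comes from some [E A0]. *)
have [[A0 SA0]|S0] := pselect (exists A, S A); last first.
  have [v Vv v0] := Vn; exists v => //; split=> // A SA.
  by exfalso; apply: S0; exists A.
(* The sets [E A] have the finite intersection property: rescale a common eigenvector of finitely
   many operators to norm 1. *)
have /finI_filter EF : finI S E.
  move=> D DS; have DSA A : A \in D -> S A by move=> /DS /set_mem.
  have [||v Vv [v0 Ev]] := @common_eigenvector_seq D V Vs Vc Vn.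
  - by move=> A /DSA; exact: VS.
  - by move=> A B /DSA SA /DSA SB; exact: SC.
  have N0 := sum_norm_gt0 v0.
  exists (emb_inv (sum_norm v)^-1 *: v) => A /= /Ev[a Av]; split.
  - exact: VZ.
  - by rewrite sum_normZ emb_invK ?invr_ge0 ?(ltW N0)// mulVf ?gt_eqF.
  - by exists a; rewrite -scalemxAr Av !scalerA mulrC.
have [G [GU sG]] := ultraFilterLemma EF.
have GE A : S A -> \forall v \near G, E A v.
  by move=> SA; apply: sG; exists (E A) => //; exact: finI_from1.
have [l vl] : exists l, tends G id l.
  apply: (@tends_ultra _ _ _ 1) => //.
  by apply: filterS (GE _ SA0) => v [_ v1 _]; rewrite v1.
have Vl : V l by apply: (Vc _ _ _ _ _ _ vl); apply: filterS (GE _ SA0) => v [].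
have l1 : sum_norm l = 1.
  have v1G : sum_norm v @[v --> G] --> (1 : R).
    by apply: cvg_near_cst; apply: filterS (GE _ SA0) => v [_ ->].
  exact: cvg_unique (tends_sum_norm vl) v1G.
exists l => //; split=> [|A SA].
  by apply: sum_norm_neq0; rewrite l1 oner_neq0.
exists (emb_inv (sum_norm (A *m l))).
have Avl : tends G (fun v => A *m v) (A *m l) by exact: tends_mul.
apply: (tends_unique Avl).
apply: (@tends_near _ _ (fun v => emb_inv (sum_norm (A *m v)) *: v)).
  apply: filterS (GE _ SA) => v [_ v1 [a Av]].
  rewrite Av sum_normZ v1 mulr1; congr (_ *: v).
  by apply: (emb_inj pE); rewrite emb_invK.
apply: tends_scale => //; rewrite emb_invK ?sum_norm_ge0//.
under eq_fun do rewrite emb_invK ?sum_norm_ge0//.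
exact: tends_sum_norm Avl.
Qed.

End Embedding.

(** * The two nonnegative semifields *)

Lemma initial_cvg (S : choiceType) (U : topologicalType) (g : S -> U)
    (T : Type) (F : set_system T) (f : T -> S) (a : S) : Filter F ->
  g (f x) @[x --> F] --> g a -> f x @[x --> F] --> (a : initial_topology g).
Proof.
move=> FF fa A [B [[C Cop <-] Ba] BA]; apply: filterS BA _.
by apply: fa; exact: open_nbhs_nbhs.
Qed.

Lemma nonneg_real_embedding (R : realType) :
  nonneg_embedding (fun x : nonneg_real R => x%:num : R).
Proof.
split.
- exact: val_inj.
- by move=> a; exact: ge0.
- by move=> x x0; exists (NngNum x0).
- by [].
- by [].
- by move=> a b; rewrite lerDl.
- by move=> a b c; rewrite /= lerD2r.
- by move=> T F f g a b FF fa gb; exact: cvgD.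
- by move=> T F f a FF; exact: initial_cvg.
Qed.

Lemma max_times_embedding (R : realType) :
  nonneg_embedding (fun x : max_times R => (x : nonneg_real R)%:num : R).
Proof.
have addE (a b : max_times R) : ((a + b : max_times R) : nonneg_real R)%:num =
    Num.max (a : nonneg_real R)%:num (b : nonneg_real R)%:num.
  by apply: (fun_if (fun x : nonneg_real R => x%:num : R)).
split.
- exact: val_inj.
- by move=> a; exact: ge0.
- by move=> x x0; exists (NngNum x0).
- by [].
- by move=> a b; rewrite addE ge_max lerDl lerDr !ge0.
- by move=> a b; rewrite addE le_max lexx.
- by move=> a b c ab; rewrite !addE ge_max !le_max ab lexx orbT.
(* The maximum is half of [a + b + |a - b|], which reduces its continuity to that of the norm. *)
- move=> T F f g a b FF fa gb; rewrite addE maxr_absE.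
  under eq_fun do rewrite addE maxr_absE.
  apply: cvgM; last exact: cvg_cst.
  by apply: cvgD; [exact: cvgD|apply: cvg_norm; exact: cvgB].
- by move=> T F f a FF; exact: initial_cvg.
Qed.

(** * Linear algebra over an algebraically closed field *)

Section ClosedField.
Context {C : closedFieldType} {n : nat}.
Implicit Types (W : set 'cV[C]_n) (A : 'M[C]_n) (S : set 'M[C]_n).

(** [is_subspace] expects topological scalars, whereas this part is purely algebraic. *)
Definition subspace W :=
  [/\ W 0, forall u v, W u -> W v -> W (u + v) & forall a v, W v -> W (a *: v)].

(** By Cayley-Hamilton the product of the factors [A - z] over the roots kills [v]. Applying the
    factors one at a time, the last nonzero vector is an eigenvector, and it stays in [W]. *)
Lemma eigenvector_closed_field W A : subspace W ->
  (forall v, W v -> W (A *m v)) -> (exists2 v, W v & v != 0) ->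
  exists2 v, W v & v != 0 /\ exists a, A *m v = a *: v.
Proof.
move=> [W0 WD WZ] WA [v Wv v0].
(* Positive dimension is required for square matrices to form a nonzero ring. *)
case: n W A W0 WD WZ WA v Wv v0 => [|m] W A W0 WD WZ WA v Wv v0.
  by rewrite flatmx0 eqxx in v0.
have [rs charA] := closed_field_poly_normal (char_poly A).
have : (\prod_(z <- rs) (A - z%:M)) *m v = 0.
  have := Cayley_Hamilton A; rewrite charA (monicP (char_poly_monic A)) scale1r.
  rewrite rmorph_prod /= => prod0.
  rewrite (_ : \prod_(z <- rs) _ = 0) ?mul0mx// -[RHS]prod0.
  by apply: eq_bigr => z _; rewrite rmorphB /= horner_mx_X horner_mx_C.
elim: rs {charA} => [|z rs IHrs].
  by rewrite big_nil mul1mx => /eqP; rewrite (negPf v0).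
rewrite big_cons -mulmxA; set u := _ *m v => Azu.
have Wu : W u.
  rewrite /u; elim: rs {IHrs u Azu} => [|y rs IHrs].
    by rewrite big_nil mul1mx.
  rewrite big_cons -mulmxA mulmxBl mul_scalar_mx -scaleNr.
  by apply: WD; [exact: WA|exact: WZ].
have [/IHrs//|u0] := eqVneq u 0.
exists u => //; split=> //; exists z.
by apply/eqP; rewrite -subr_eq0 -mul_scalar_mx -mulmxBl Azu.
Qed.

Lemma common_eigenvector_closed_field W S : subspace W ->
  (exists2 v, W v & v != 0) ->
  (forall A, S A -> forall v, W v -> W (A *m v)) ->
  (forall A B, S A -> S B -> A *m B = B *m A) ->
  exists2 v, W v & v != 0 /\ forall A, S A -> exists a, A *m v = a *: v.
Proof.
move=> Ws Wn WS SC.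
(* The induction is on a bound for the dimension of the subspaces inside [W]: an
   eigenspace of a non-scalar operator lowers it. *)
have : forall U : {vspace 'cV[C]_n}, (forall v, v \in U -> W v) ->
    (\dim U <= \dim {: 'cV[C]_n})%N by move=> U _; exact: dimvS (subvf U).
elim: (\dim _) W Ws Wn WS => [|d IHd] W Ws [v Wv v0] WS Wd.
  have [_ _ WZ] := Ws.
  have := Wd <[v]>%VS; rewrite dim_vline v0 => /(_ _)/wrap[|//].
  by move=> _ /vlineP[a ->]; exact: WZ.
(* Unless [v] is already a common eigenvector, some [A] has [v] outside all its eigenspaces. *)
have [Wscal|] := pselect (forall A, S A -> exists a, A *m v = a *: v).
  by exists v.
move=> /existsNP[A /not_implyP[SA Av]].
have [u Wu [u0 [a Au]]] :=
  eigenvector_closed_field Ws (WS A SA) (ex_intro2 _ _ v Wv v0).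
pose W' := [set x | W x /\ A *m x = a *: x].
have [W0 WD WZ] := Ws.
have [||B SB x [Wx Ax]|U UW'|x [Wx _] Ex] := IHd W'; last by exists x.
- split=> [|x y [Wx Ax] [Wy Ay]|b x [Wx Ax]].
  + by rewrite /W' /= mulmx0 scaler0.
  + by split; [exact: WD|rewrite mulmxDr Ax Ay scalerDr].
  + by split; [exact: WZ|rewrite -scalemxAr Ax !scalerA mulrC].
- by exists u.
- split; first exact: WS.
  by rewrite mulmxA (SC A B)// -mulmxA Ax scalemxAr.
have vU : v \notin U by apply/negP => /UW'[_ Av']; apply: Av; exists a.
(* A subspace [U] of the eigenspace misses [v], so adjoining [v] raises its dimension by one while
   staying inside [W]. *)
have : (\dim (U + <[v]>)%VS <= d.+1)%N.
  apply: Wd => _ /memv_addP[x /UW'[Wx _] [_ /vlineP[b ->] ->]].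
  by apply: WD => //; exact: WZ.
rewrite dimv_disjoint_sum ?dim_vline ?v0 ?addn1//.
apply/eqP; rewrite -subv0; apply/subvP => x /memv_capP[xU /vlineP[b xb]].
rewrite memv0; apply: contraR vU => x0.
have b0 : b != 0 by apply: contraNneq x0 => b0; rewrite xb b0 scale0r.
by rewrite -(scalerK b0 v) -xb memvZ.
Qed.

End ClosedField.

Theorem theorem2p1 (R : realType) (k : scalar_kind) (n : nat)
    (V : set 'cV[scalars R k]_n) (S : set 'M[scalars R k]_n) :
  is_subspace V -> nontrivial V -> closed V ->
  is_semigroup S -> commutative_family S ->
  (forall A, S A -> leaves_invariant A V) ->
  exists2 v : 'cV[scalars R k]_n, V v & is_common_eigenvector S v.
Proof.
move=> Vs Vn Vc _ SC VS; case: k V S Vs Vn Vc SC VS => V S Vs Vn Vc SC VS.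
- exact: (@common_eigenvector_closed_field R[i] n V S).
- have pE := nonneg_real_embedding R.
  exact: (common_eigenvector_family pE Vs (closed_tends pE Vc)).
- have pE := max_times_embedding R.
  exact: (common_eigenvector_family pE Vs (closed_tends pE Vc)).
Qed.
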